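(* Let $G$ be a groupoid, let $S$ be a nearly epsilon-strongly $G$-graded ring, let $G':=\{g \in G: S_{s(g)}\neq\{0\} \text{ and } S_{r(g)}\neq\{0\}\}$ and let $G_0' := G'\cap G_0=\{e\in G_0 : S_e\neq\{0\}\}$. The following statements are equivalent: (i) $S$ is prime; (ii) $\oplus_{e \in G_0}S_e$ is $G$-prime, and for every $e \in G_0'$, $\oplus_{g \in G_e^e}S_g$ is prime; (iii) $\oplus_{e \in G_0}S_e$ is $G$-prime, and for some $e \in G_0'$, $\oplus_{g \in G_e^e}S_g$ is prime; (iv) $S$ is graded prime, and for every $e \in G_0'$, $\oplus_{g \in G_e^e}S_g$ is prime; (v) $S$ is graded prime, and for some $e \in G_0'$, $\oplus_{g \in G_e^e}S_g$ is prime; (vi) for every $e \in G_0'$, $e$ is a support-hub and $\oplus_{g \in G_e^e}S_g$ is prime; (vii) for some $e \in G_0'$, $e$ is a support-hub and $\oplus_{g \in G_e^e}S_g$ is prime.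
   Context: All rings are associative but not necessarily unital; ideals are two-sided. A groupoid $G$ is a small category in which every morphism is invertible; $G$ also denotes its set of morphisms. Objects are identified with their identity morphisms, so the set of objects $G_0$ is a subset of $G$. The maps $s,r:G\to G_0$ are source (domain) and range (codomain); $gh$ is defined if and only if $s(g)=r(h)$. For $e\in G_0$, $G_e^e:=\{g\in G: s(g)=r(g)=e\}$ is the isotropy group. A ring $S$ is $G$-graded if there are additive subgroups $S_g$ ($g\in G$) with $S=\oplus_{g\in G}S_g$, $S_gS_h\subseteq S_{gh}$ if $s(g)=r(h)$, and $S_gS_h=\{0\}$ otherwise. For subsets $X,Y$ of a ring, $XY$ denotes the set of finite sums of products $xy$ with $x\in X$, $y\in Y$ (similarly for more factors). For $H\subseteq G$ closed under inverses and under defined compositions, $\oplus_{h\in H}S_h$ is a subring of $S$; in particular so are $\oplus_{e\in G_0}S_e$ and $\oplus_{g\in G_e^e}S_g$. A ring $R$ is $s$-unital if for every $x\in R$ there are $a,b\in R$ with $ax=x=xb$. A $G$-graded ring $S$ is nearly epsilon-strongly $G$-graded if for each $g\in G$, $S_gS_{g^{-1}}$ is an $s$-unital ring and $S_gS_{g^{-1}}S_g=S_g$. A ring is prime if it has no nonzero ideals $I,J$ with $IJ=\{0\}$. An ideal $I$ of $S$ is a graded ideal if $I=\oplus_{g\in G}(I\cap S_g)$; $S$ is graded prime if there are no nonzero graded ideals $I,J$ of $S$ with $IJ=\{0\}$. A subset $I\subseteq S$ is $G$-invariant if $S_{g^{-1}}IS_g\subseteq I$ for every $g\in G$; $\oplus_{e\in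 G_0}S_e$ is $G$-prime if there are no nonzero $G$-invariant ideals $I,J$ of the ring $\oplus_{e\in G_0}S_e$ with $IJ=\{0\}$. An element $e\in G_0'$ is a support-hub if for every $g\in G$ and every nonzero $a_g\in S_g$ there are $h,k\in G$ with $s(h)=e$, $r(k)=e$ such that $a_gS_h$ and $S_ka_g$ are both nonzero.
   Formalization: The formal theorem assumes in addition that S is not the zero ring; for S = {0} the set G_0' is empty, so (i), (ii), (iv), (vi) hold vacuously while (iii), (v), (vii) fail, and the stated equivalence is false in that case only. *)

(* Defs.v *)
From HB Require Import structures.
From mathcomp Require Import all_boot all_order all_algebra.
From mathcomp Require Import mathcomp_extra boolp classical_sets functions.
From mathcomp Require Import cardinality fsbigop.

Set Implicit Arguments.
Unset Strict Implicit.
Unset Printing Implicit Defensive.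

Import GRing.Theory.

Local Open Scope classical_set_scope.
Local Open Scope ring_scope.

(** Associative rings, not necessarily unital. *)
HB.mixin Record Zmodule_isRng R of GRing.Zmodule R := {
  rmul : R -> R -> R;
  rmulA : associative rmul;
  rmulDl : left_distributive rmul +%R;
  rmulDr : right_distributive rmul +%R
}.

#[short(type="rngType")]
HB.structure Definition Rng := {R of Zmodule_isRng R & GRing.Zmodule R}.

Notation "x ** y" := (rmul x y) (at level 40, left associativity) : ring_scope.

(** A groupoid is a small category in which every morphism is invertible.
    [gcomp g h] is only meaningful when [gsource g = grange h]; its value is arbitrary
    and unconstrained otherwise.  Objects are identified with
    identity morphisms through the injection [idm]. *)
Record groupoid := Groupoid {
  obj : Type;
  arr :> choiceType;
  gsource : arr -> obj;
  grange : arr -> obj;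
  idm : obj -> arr;
  gcomp : arr -> arr -> arr;
  ginv : arr -> arr;
  gsource_idm : forall e, gsource (idm e) = e;
  grange_idm : forall e, grange (idm e) = e;
  gsource_gcomp : forall g h, gsource g = grange h -> gsource (gcomp g h) = gsource h;
  grange_gcomp : forall g h, gsource g = grange h -> grange (gcomp g h) = grange g;
  gcompA : forall g h k, gsource g = grange h -> gsource h = grange k ->
    gcomp g (gcomp h k) = gcomp (gcomp g h) k;
  gcomp_id_l : forall g, gcomp (idm (grange g)) g = g;
  gcomp_id_r : forall g, gcomp g (idm (gsource g)) = g;
  gsource_ginv : forall g, gsource (ginv g) = grange g;
  grange_ginv : forall g, grange (ginv g) = gsource g;
  gcompVg : forall g, gcomp (ginv g) g = idm (gsource g);
  gcompgV : forall g, gcomp g (ginv g) = idm (grange g)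
}.

Definition identities (G : groupoid) : set G := range (@idm G).

Definition isotropy (G : groupoid) (e : obj G) : set G :=
  [set g | gsource g = e /\ grange g = e].

Section Rings.
Variable S : rngType.
Implicit Types (X Y T I J : set S).

(** Finite sums of products; since [rmul] distributes over sums,
    [X `** Y `** Z] is the set of finite sums of products [x ** y ** z]. *)
Definition mulset X Y : set S :=
  [set z | exists2 s : seq (S * S),
     (forall p, p \in s -> X p.1 /\ Y p.2) & z = \sum_(p <- s) p.1 ** p.2].

Definition additive_subgroup X : Prop :=
  X 0 /\ forall x y, X x -> X y -> X (x - y).

(** [ideal_of T I]: [I] is a two-sided ideal of the subring [T] of [S]. *)
Definition ideal_of T I : Prop :=
  [/\ I `<=` T, additive_subgroup I,
      forall t x, T t -> I x -> I (t ** x) &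
      forall t x, T t -> I x -> I (x ** t)].

Definition no_zero_product (P : set S -> Prop) : Prop :=
  ~ exists I J, [/\ P I, P J, I <> [set 0], J <> [set 0]
                  & mulset I J = [set 0]].

(** Primeness of the subring [T]. *)
Definition prime_ring T : Prop := no_zero_product (ideal_of T).

Definition s_unital T : Prop :=
  forall x, T x -> exists a b, [/\ T a, T b, a ** x = x & x ** b = x].

End Rings.

Notation "X `** Y" := (mulset X Y) (at level 40, left associativity)
  : classical_set_scope.

Section Graded.
Variables (G : groupoid) (S : rngType).
Implicit Types (A : G -> set S) (I : set S).

(** The sum of the [A h], [h \in H]; it is direct when [A] is a grading. *)
Definition dsum (H : set G) A : set S :=
  [set x | exists c : G -> S,
     [/\ forall g, H g -> A g (c g),
         finite_set (H `&` [set g | c g <> 0])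
       & x = \sum_(g \in H) c g]].

Record graded A : Prop := Graded {
  graded_subgroup : forall g, additive_subgroup (A g);
  graded_span : dsum setT A = setT;
  graded_direct : forall c : G -> S, (forall g, A g (c g)) ->
    finite_set [set g | c g <> 0] -> \sum_(g \in setT) c g = 0 ->
    forall g, c g = 0;
  graded_mul : forall g h, gsource g = grange h -> A g `** A h `<=` A (gcomp g h);
  graded_mul0 : forall g h, gsource g <> grange h -> A g `** A h = [set 0]
}.

Definition nearly_epsilon_strongly_graded A : Prop :=
  graded A /\
  forall g, s_unital (A g `** A (ginv g)) /\
            A g `** A (ginv g) `** A g = A g.

Definition graded_ideal A I : Prop :=
  ideal_of setT I /\ I = dsum setT (fun g => I `&` A g).

Definition graded_prime A : Prop := no_zero_product (graded_ideal A).

Definition invariant A I : Prop :=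
  forall g, A (ginv g) `** I `** A g `<=` I.

(** [G]-primeness of the sum of the [S_e], [e] ranging over the objects. *)
Definition G_prime A : Prop :=
  no_zero_product
    (fun I => ideal_of (dsum (@identities G) A) I /\ invariant A I).

(** The set [G_0'] of the objects [e] with [S_e <> 0]. *)
Definition supp_obj A : set (obj G) := [set e | A (idm e) <> [set 0]].

Definition support_hub A (e : obj G) : Prop :=
  forall g a, A g a -> a <> 0 ->
    exists h k, [/\ gsource h = e, grange k = e,
      [set a] `** A h <> [set 0] & A k `** [set a] <> [set 0]].

End Graded.

(* Main.v *)
Require Import Defs.
From mathcomp Require Import all_boot all_order all_algebra.
From mathcomp Require Import boolp classical_sets.
From mathcomp Require Import cardinality fsbigop.

(** The whole equivalence rests on an elementwise form of primeness.  In a ring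
    [T] where every nonzero [x] satisfies [a ** x ** b <> 0] for some [a], [b]
    in [T], primeness means that nonzero [x], [y] always admit [t] in [T] with
    [x ** t ** y <> 0] ([prime_ringP]); the ideals to test are the principal
    ones.  Near epsilon-strength provides such [a] and [b], in [S] and in the
    isotropy rings alike, because it gives each homogeneous element local units
    on both sides that live over the objects ([homogeneous_unit_l],
    [homogeneous_unit_r]).

    Primeness of [S] comes from a single support-hub with prime isotropy ring
    ([prime_of_support_hub]).  If [e] is a support-hub and [x] is nonzero, a
    nonzero homogeneous component of [x] can be moved by homogeneous factors
    [p], [q] so that it becomes a nonzero element of the isotropy ring at [e].
    Composition in a groupoid is cancellative, so different components of [x]
    contribute to different degrees of [p ** x ** q], which is therefore itself
    nonzero
    ([homogeneous_component], [support_hub_corner]).  Doing this to both [x]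
    and [y], an element of the isotropy ring that separates the two corners
    yields an element of [S] that separates [x] and [y].

    The other conditions are linked to this one as follows.  In a graded prime
    ring homogeneous nonzero elements are separated by homogeneous elements, so
    every object of the support is a support-hub
    ([graded_prime_support_hub]).  A prime [S] has prime isotropy rings, because
    a homogeneous element that separates two elements of an isotropy ring has
    its degree in the isotropy group ([prime_isotropy]).  Finally, graded primeness of [S] is the same as
    [G]-primeness of the sum of the [S_e]: a graded ideal leaves a nonzero
    invariant trace on that sum ([G_prime_graded_prime]), while a zero product
    of invariant ideals would contradict the separation of homogeneous elements
    ([graded_prime_G_prime]). *)

Import GRing.Theory.

Local Open Scope classical_set_scope.
Local Open Scope ring_scope.

(** * Ideals and primeness in rings without unit *)

Section RngTheory.
Context {S : rngType}.
Implicit Types (x y z : S) (X Y T I J P : set S).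

Lemma rmul0l x : 0 ** x = 0.
Proof. by apply: (@addrI _ (0 ** x)); rewrite -rmulDl !addr0. Qed.

Lemma rmul0r x : x ** 0 = 0.
Proof. by apply: (@addrI _ (x ** 0)); rewrite -rmulDr !addr0. Qed.

Lemma rmulNl x y : (- x) ** y = - (x ** y).
Proof. by apply: (@addrI _ (x ** y)); rewrite -rmulDl !subrr rmul0l. Qed.

Lemma rmulNr x y : x ** (- y) = - (x ** y).
Proof. by apply: (@addrI _ (x ** y)); rewrite -rmulDr !subrr rmul0r. Qed.

Lemma rmulBl x y z : (x - y) ** z = x ** z - y ** z.
Proof. by rewrite rmulDl rmulNl. Qed.

Lemma rmulBr x y z : x ** (y - z) = x ** y - x ** z.
Proof. by rewrite rmulDr rmulNr. Qed.

Lemma rmul_sumr (J : Type) (s : seq J) (F : J -> S) x :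
  x ** (\sum_(j <- s) F j) = \sum_(j <- s) x ** F j.
Proof.
by elim/big_ind2: _ => [|u v w t <- <-|//]; rewrite ?rmul0r ?rmulDr.
Qed.

Lemma rmul_suml (J : Type) (s : seq J) (F : J -> S) y :
  (\sum_(j <- s) F j) ** y = \sum_(j <- s) F j ** y.
Proof.
by elim/big_ind2: _ => [|u v w t <- <-|//]; rewrite ?rmul0l ?rmulDl.
Qed.

Lemma additive_subgroupD {P x y} :
  additive_subgroup P -> P x -> P y -> P (x + y).
Proof.
move=> [P0 PB] Px Py; rewrite -[y]opprK; apply: (PB) => //.
by rewrite -[- y]add0r; apply: (PB).
Qed.

Lemma additive_subgroup_sum {P} (J : eqType) (s : seq J) (Q : pred J)
    (F : J -> S) :
  additive_subgroup P -> (forall j, j \in s -> Q j -> P (F j)) ->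
  P (\sum_(j <- s | Q j) F j).
Proof.
move=> subP PF; rewrite big_seq_cond; apply: (big_ind P).
- by case: subP.
- by move=> x y; apply: additive_subgroupD.
- by move=> j /andP[]; apply: PF.
Qed.

Lemma additive_subgroupT : additive_subgroup [set: S].
Proof. by []. Qed.

Lemma additive_subgroupI {X Y} :
  additive_subgroup X -> additive_subgroup Y -> additive_subgroup (X `&` Y).
Proof.
move=> [X0 XB] [Y0 YB]; split=> // x y [Xx Yx] [Xy Yy].
by split; [apply: (XB) | apply: (YB)].
Qed.

Lemma additive_subgroup_sandwich {P} x y : additive_subgroup P ->
  additive_subgroup [set z | P (x ** z ** y)].
Proof.
move=> [P0 PB]; split=> [|u v /= Pu Pv] /=; first by rewrite rmul0r rmul0l.
by rewrite rmulBr rmulBl; apply: (PB).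
Qed.

Lemma additive_subgroup_mull {P} x : additive_subgroup P ->
  additive_subgroup [set z | P (x ** z)].
Proof.
move=> [P0 PB]; split=> [|u v /= Pu Pv] /=; first by rewrite rmul0r.
by rewrite rmulBr; apply: (PB).
Qed.

Lemma additive_subgroup_mulr {P} y : additive_subgroup P ->
  additive_subgroup [set z | P (z ** y)].
Proof.
move=> [P0 PB]; split=> [|u v /= Pu Pv] /=; first by rewrite rmul0l.
by rewrite rmulBl; apply: (PB).
Qed.

Lemma additive_subgroup0 : additive_subgroup [set (0 : S)].
Proof. by split=> // x y /= -> ->; rewrite subrr. Qed.

Lemma nonzeroP {X} : X 0 -> X <> [set 0] -> exists2 x, X x & x <> 0.
Proof.
move=> X0 Xn0; apply: contrapT => nX; apply: Xn0; apply/seteqP; split=> x /=.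
  by move=> Xx; apply: contrapT => xn0; apply: nX; exists x.
by move->.
Qed.

Lemma neq_set0_of {X} x : X x -> x <> 0 -> X <> [set 0].
Proof. by move=> Xx xn0 X0; apply: xn0; move: Xx; rewrite X0. Qed.

Lemma mem_mulset X Y x y : X x -> Y y -> (X `** Y) (x ** y).
Proof.
move=> Xx Yy; exists [:: (x, y)]; last by rewrite big_seq1.
by move=> p; rewrite inE => /eqP ->.
Qed.

Lemma mulset_sub X Y P : additive_subgroup P ->
  (forall x y, X x -> Y y -> P (x ** y)) -> X `** Y `<=` P.
Proof.
move=> subP XYP z [s sXY ->]; apply: additive_subgroup_sum => // p /sXY[Xp Yp] _.
exact: XYP.
Qed.

Lemma mulset_additive X Y : additive_subgroup X -> additive_subgroup (X `** Y).
Proof.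
move=> subX; split; first by exists [::]; rewrite ?big_nil.
move=> _ _ [s sXY ->] [t tXY ->].
exists (s ++ [seq (- p.1, p.2) | p <- t]).
  move=> p; rewrite mem_cat => /orP[/sXY //|/mapP[q /tXY[Xq Yq] ->]]; split=> //=.
  by case: subX => X0 XB; rewrite -sub0r; apply: (XB).
rewrite big_cat big_map /= -sumrN; congr (_ + _).
by apply: eq_bigr => p _; rewrite rmulNl.
Qed.

Lemma mulset_assoc_sub X Y Z : additive_subgroup X ->
  X `** Y `** Z `<=` X `** (Y `** Z).
Proof.
move=> subX; have subXYZ := mulset_additive X (Y `** Z) subX.
apply: mulset_sub => // w z + Zz; move: w; apply: mulset_sub.
  exact: additive_subgroup_mulr.
by move=> x y Xx Yy /=; rewrite -rmulA; do 2!apply: mem_mulset => //.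
Qed.

Lemma mulset_eq0P X Y :
  X `** Y = [set 0] <-> (forall x y, X x -> Y y -> x ** y = 0).
Proof.
split=> [XY0 x y Xx Yy|XY0].
  by have := mem_mulset _ _ _ _ Xx Yy; rewrite XY0.
apply/seteqP; split; first exact: mulset_sub additive_subgroup0 XY0.
by move=> _ ->; exists [::]; rewrite ?big_nil.
Qed.

Lemma mulset_neq0P X Y :
  X `** Y <> [set 0] <-> exists x y, [/\ X x, Y y & x ** y <> 0].
Proof.
split=> [XYn0|[x [y [Xx Yy xyn0]]] /mulset_eq0P XY0]; last exact/xyn0/XY0.
apply: contrapT => nXY; apply/XYn0/mulset_eq0P => x y Xx Yy.
by apply: contrapT => xyn0; apply: nXY; exists x, y.
Qed.

Lemma no_zero_productP {P : set S -> Prop} :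
  (forall I, P I -> additive_subgroup I) ->
  no_zero_product P <->
  (forall I J x y, P I -> P J -> I x -> J y -> x <> 0 -> y <> 0 ->
     exists a b, [/\ I a, J b & a ** b <> 0]).
Proof.
move=> addP; split=> [nP I J x y PI PJ Ix Jy xn0 yn0|nP [I [J [PI PJ In0 Jn0 IJ0]]]].
  apply/mulset_neq0P => IJ0; apply: nP; exists I, J; split=> //.
    exact: neq_set0_of Ix xn0.
  exact: neq_set0_of Jy yn0.
have [x Ix xn0] := nonzeroP (addP _ PI).1 In0.
have [y Jy yn0] := nonzeroP (addP _ PJ).1 Jn0.
have /mulset_neq0P := nP I J x y PI PJ Ix Jy xn0 yn0; exact.
Qed.

Lemma ideal_additive {T I} : ideal_of T I -> additive_subgroup I.
Proof. by case. Qed.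

Definition subrng T :=
  additive_subgroup T /\ forall x y, T x -> T y -> T (x ** y).

(** The products with a factor from [T] on both sides only: this is an ideal of
    [T], but without local units it need not contain [x]. *)
Definition principal T x := T `** [set x] `** T.

Lemma principalP T x : additive_subgroup T ->
  additive_subgroup (principal T x) /\
  forall a b, T a -> T b -> principal T x (a ** x ** b).
Proof.
move=> subT; split; first exact/mulset_additive/mulset_additive.
by move=> a b Ta Tb; apply: mem_mulset => //; apply: mem_mulset.
Qed.

(** Its elements are sums of sums of products; containment in an additive
    subgroup is all that is ever needed about them, and is decided on the
    products [a ** x ** b]. *)
Lemma principal_sub T x P : additive_subgroup P ->
  (forall a b, T a -> T b -> P (a ** x ** b)) -> principal T x `<=` P.
Proof.
move=> subP TP; apply: mulset_sub => // z b Tz Tb; move: z Tz.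
by apply: mulset_sub => [|a _ Ta ->]; [apply: additive_subgroup_mulr | apply: TP].
Qed.

Lemma principal_ideal T x : subrng T -> T x -> ideal_of T (principal T x).
Proof.
move=> [subT TM] Tx; have [subI mI] := principalP T x subT.
split=> //.
- by apply: principal_sub => // a b Ta Tb; apply: (TM) => //; apply: (TM).
- move=> t + Tt; apply: principal_sub; first exact: additive_subgroup_mull.
  by move=> a b Ta Tb; rewrite !rmulA; apply: (mI) => //; apply: (TM).
- move=> t + Tt; apply: principal_sub; first exact: additive_subgroup_mulr.
  by move=> a b Ta Tb; rewrite -rmulA; apply: (mI) => //; apply: (TM).
Qed.

Lemma principal_mul_eq0 T x y : subrng T ->
  (forall t, T t -> x ** t ** y = 0) ->
  forall a b, principal T x a -> principal T y b -> a ** b = 0.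
Proof.
move=> [subT TM] xTy a b xa; move: b.
apply: (principal_sub _ _ [set b | a ** b = 0]).
  exact: additive_subgroup_mull additive_subgroup0.
move=> c d Tc Td /=; rewrite !rmulA.
move: a xa; apply: (principal_sub _ _ [set a | a ** c ** y ** d = 0]).
  apply: (additive_subgroup_mulr c (P := [set z | z ** y ** d = 0])).
  apply: (additive_subgroup_mulr y (P := [set z | z ** d = 0])).
  exact: additive_subgroup_mulr additive_subgroup0.
move=> a b Ta Tb /=.
have -> : a ** x ** b ** c ** y ** d = a ** (x ** (b ** c) ** y) ** d.
  by rewrite !rmulA.
by rewrite xTy ?rmul0r ?rmul0l //; apply: (TM).
Qed.

(** The factors [a], [b] are there to make [principal T x] nonzero when [x] is:
    then two nonzero elements that no [t] separates generate nonzero principal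
    ideals whose product is zero. *)
Lemma prime_ringP T : subrng T ->
  (forall x, T x -> x <> 0 -> exists a b, [/\ T a, T b & a ** x ** b <> 0]) ->
  prime_ring T <->
  (forall x y, T x -> T y -> x <> 0 -> y <> 0 ->
     exists2 t, T t & x ** t ** y <> 0).
Proof.
move=> subT facT; split=> [/(no_zero_productP (@ideal_additive _)) pT|pT].
  move=> x y Tx Ty xn0 yn0; apply: contrapT => nt.
  have xTy t : T t -> x ** t ** y = 0.
    by move=> Tt; apply: contrapT => xtyn0; apply: nt; exists t.
  have [a [b [Ta Tb axb]]] := facT x Tx xn0.
  have [c [d [Tc Td cyd]]] := facT y Ty yn0.
  have [_ mx] := principalP T x subT.1.
  have [_ my] := principalP T y subT.1.
  have [u [v [Iu Iv]]] := pT _ _ _ _ (principal_ideal _ _ subT Tx)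
    (principal_ideal _ _ subT Ty) (mx _ _ Ta Tb) (my _ _ Tc Td) axb cyd.
  by rewrite (principal_mul_eq0 _ _ _ subT xTy).
apply/(no_zero_productP (@ideal_additive _)).
move=> I J x y [IT _ _ IM] [JT _ _ _] Ix Jy xn0 yn0.
have [t Tt xty] := pT x y (IT _ Ix) (JT _ Jy) xn0 yn0.
by exists (x ** t), y; split=> //; apply: IM.
Qed.

(** Tominaga's lemma: if [u] is a left unit for [xs], and [v] one for
    [x - u ** x], then [u + v - v ** u], which is [1 - (1 - v) ** (1 - u)]
    in a ring with unit, is a left unit for [x :: xs]. *)
Lemma common_unit_l T (xs : seq S) : subrng T -> s_unital T ->
  (forall x, x \in xs -> T x) ->
  exists2 u, T u & forall x, x \in xs -> u ** x = x.
Proof.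
move=> [subT TM] unitT; elim: xs => [|x xs IHxs] Txs.
  by exists 0 => //; case: subT.
have [y ys|u Tu ux] := IHxs; first by apply: Txs; rewrite inE ys orbT.
have Tx : T x by apply: Txs; rewrite mem_head.
have Txu : T (x - u ** x) by apply: subT.2 => //; apply: (TM).
have [v [_ [Tv _ vx _]]] := unitT _ Txu.
exists (u + v - v ** u).
  by apply: subT.2; [apply: additive_subgroupD | apply: (TM)].
move=> y; rewrite inE rmulBl rmulDl -rmulA => /orP[/eqP ->|/ux ->].
  by rewrite -addrA -rmulBr vx addrC subrK.
by rewrite addrK.
Qed.

Lemma common_unit_r T (xs : seq S) : subrng T -> s_unital T ->
  (forall x, x \in xs -> T x) ->
  exists2 u, T u & forall x, x \in xs -> x ** u = x.
Proof.
move=> [subT TM] unitT; elim: xs => [|x xs IHxs] Txs.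
  by exists 0 => //; case: subT.
have [y ys|u Tu xu] := IHxs; first by apply: Txs; rewrite inE ys orbT.
have Tx : T x by apply: Txs; rewrite mem_head.
have Txu : T (x - x ** u) by apply: subT.2 => //; apply: (TM).
have [_ [v [_ Tv _ xv]]] := unitT _ Txu.
exists (u + v - u ** v).
  by apply: subT.2; [apply: additive_subgroupD | apply: (TM)].
move=> y; rewrite inE rmulBr rmulDr rmulA => /orP[/eqP ->|/xu ->].
  by rewrite -addrA -rmulBl xv addrC subrK.
by rewrite addrK.
Qed.

End RngTheory.

(** * Cancellation in groupoids *)

Section GroupoidTheory.
Context {G : groupoid}.
Implicit Types g h k : G.

Lemma ginvK g : ginv (ginv g) = g.
Proof.
have sg : gsource (ginv (ginv g)) = grange (ginv g) by rewrite gsource_ginv.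
have sr : gsource (ginv g) = grange g by rewrite gsource_ginv.
rewrite -[LHS]gcomp_id_r gsource_ginv grange_ginv -gcompVg gcompA //.
by rewrite gcompVg gsource_ginv gcomp_id_l.
Qed.

Lemma gcompIl k g h : gsource k = grange g -> gsource k = grange h ->
  gcomp k g = gcomp k h -> g = h.
Proof.
move=> kg kh /(congr1 (gcomp (ginv k))).
rewrite !gcompA ?gsource_ginv // gcompVg {1}kg kh.
by rewrite !gcomp_id_l.
Qed.

Lemma gcompIr k g h : gsource g = grange k -> gsource h = grange k ->
  gcomp g k = gcomp h k -> g = h.
Proof.
move=> gk hk /(congr1 (fun m => gcomp m (ginv k))).
rewrite -!gcompA ?grange_ginv // gcompgV -{1}gk -hk.
by rewrite !gcomp_id_r.
Qed.

Definition gcomp_closed (H : set G) := forall g h,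
  H g -> H h -> gsource g = grange h -> H (gcomp g h).

Lemma identities_closed : gcomp_closed (@identities G).
Proof.
move=> _ _ [e _ <-] [f _ <-]; rewrite gsource_idm grange_idm => ef; exists e => //.
by have := gcomp_id_l (idm f); rewrite grange_idm ef => ->.
Qed.

Lemma isotropy_closed e : gcomp_closed (isotropy e).
Proof.
by move=> g h [sg rg] [sh rh] gh; split; rewrite ?gsource_gcomp ?grange_gcomp.
Qed.

Lemma gcomp_closedT : gcomp_closed [set: G].
Proof. by []. Qed.

End GroupoidTheory.

(** * Sums of families of additive subgroups *)

Section DirectSums.
Context {G : groupoid} {S : rngType}.
Implicit Types (H : set G) (B : G -> set S) (P : set S) (x y : S).

Lemma dsum_seq H B x : dsum H B x -> exists (s : seq G) (c : G -> S),
  [/\ uniq s, forall g, g \in s -> H g /\ B g (c g) & x = \sum_(g <- s) c g].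
Proof.
move=> [c [Bc finc ->]]; exists (finite_support 0 H c), c; split=> // g.
by rewrite in_finite_support // inE => -[Hg _]; split=> //; apply: Bc.
Qed.

(** Induction on [dsum]: together with [mem_dsum] and [dsum_additive] it allows
    to check statements that are additive in [x] on homogeneous elements. *)
Lemma dsum_sub H B P : additive_subgroup P ->
  (forall g, H g -> B g `<=` P) -> dsum H B `<=` P.
Proof.
move=> subP BP x /dsum_seq [s [c [_ sc ->]]].
by apply: additive_subgroup_sum => // g /sc[/BP BgP /BgP].
Qed.

Lemma dsum_additive H B :
  (forall g, additive_subgroup (B g)) -> additive_subgroup (dsum H B).
Proof.
move=> subB; split.
  exists (fun=> 0); split=> [g _||]; first by case: (subB g).
    by rewrite (_ : _ `&` _ = set0) ?finite_set0 //; apply/seteqP; split=> g // [].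
  by rewrite fsbig1.
move=> _ _ [c [Bc finc ->]] [d [Bd find ->]].
exists (fun g => c g - d g); split=> [g Hg||].
- by apply: (subB g).2; [apply: Bc | apply: Bd].
- have fincd : finite_set ((H `&` [set g | c g <> 0]) `|`
      (H `&` [set g | d g <> 0])) by rewrite finite_setU.
  apply: sub_finite_set fincd.
  move=> g /= [Hg cdn0]; have [cg0|cgn0] := pselect (c g = 0); last by left.
  by right; split=> // dg0; apply: cdn0; rewrite cg0 dg0 subrr.
  (* The supports of [c], [d] and [c - d] differ, so all three sums are taken
     over one list of indices that contains them. *)
- pose s := undup (finite_support 0 H c ++ finite_support 0 H d).
  have sE (f : G -> S) : (forall g, H g -> g \notin s -> f g = 0) ->
      \sum_(g \in H) f g = \sum_(g <- s) f g.
    move=> f0; rewrite (fsbigE s) ?undup_uniq //.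
      rewrite big_seq_cond [RHS]big_seq; apply: eq_bigl => g.
      case gs: (g \in s) => //=; apply/mem_set; move: gs.
      by rewrite mem_undup mem_cat !in_finite_support // => /orP[] /set_mem[].
    move=> g /=.
    by rewrite mem_undup mem_cat !in_finite_support // => /orP[] /set_mem[].
  have s0 g : H g -> g \notin s -> c g = 0 /\ d g = 0.
    move=> Hg; rewrite mem_undup mem_cat !in_finite_support // negb_or.
    move=> /andP[] /negP cg /negP dg; split.
      by apply: contrapT => n0; apply/cg/mem_set.
    by apply: contrapT => n0; apply/dg/mem_set.
  rewrite !sE ?sumrB // => g Hg gs; have [cg dg] := s0 g Hg gs => //.
  by rewrite cg dg subrr.
Qed.

Lemma mem_dsum H B g x : (forall h, additive_subgroup (B h)) ->
  H g -> B g x -> dsum H B x.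
Proof.
move=> subB Hg Bx; exists (fun h => if h == g then x else 0); split.
- by move=> h Hh; case: eqP => [->|_] //; case: (subB h).
- apply: (sub_finite_set _ (finite_set1 g)) => h /= [_].
  by case: eqP.
- rewrite (fsbigE [:: g]) //=.
  + by rewrite big_cons big_nil ifT ?eqxx ?addr0 //; apply/mem_set.
  + by move=> h /=; rewrite inE => /eqP ->.
  + by move=> h _; rewrite inE; case: eqP.
Qed.

End DirectSums.

(** * Homogeneous components *)

Section GradedTheory.
Context {G : groupoid} {S : rngType} {A : G -> set S}.
Hypothesis gA : graded A.
Implicit Types (H : set G) (g h k m : G) (a b p q x y z : S) (I J P : set S).

Let subA g : additive_subgroup (A g) := graded_subgroup gA g.

Lemma graded_mulM g h a b : gsource g = grange h ->
  A g a -> A h b -> A (gcomp g h) (a ** b).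
Proof. by move=> gh Aa Ab; apply: (graded_mul gA gh); apply: mem_mulset. Qed.

Lemma graded_mul_eq0 g h a b : gsource g <> grange h ->
  A g a -> A h b -> a ** b = 0.
Proof. by move=> gh Aa Ab; have /mulset_eq0P := graded_mul0 gA gh; apply. Qed.

Lemma graded_mul_dom g h a b : A g a -> A h b -> a ** b <> 0 ->
  gsource g = grange h.
Proof. by move=> Aa Ab abn0; apply: contrapT => /graded_mul_eq0/(_ Aa Ab)/abn0. Qed.

Lemma graded_mul_ind P g h a b : P 0 ->
  (gsource g = grange h -> P (a ** b)) -> A g a -> A h b -> P (a ** b).
Proof.
move=> P0 Pab Aa Ab; have [/Pab //|gh] := pselect (gsource g = grange h).
by rewrite (graded_mul_eq0 _ _ _ _ gh Aa Ab).
Qed.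

Lemma dsum_subrng H : gcomp_closed H -> subrng (dsum H A).
Proof.
move=> clH; have subD := dsum_additive H A subA; split=> // x y + Dy.
apply: (dsum_sub _ _ [set x | dsum H A (x ** y)]).
  exact: additive_subgroup_mulr.
move=> g Hg a Aa /=; move: y Dy; apply: (dsum_sub _ _ [set y | dsum H A (a ** y)]).
  exact: additive_subgroup_mull.
move=> h Hh b Ab; apply: (graded_mul_ind (dsum H A) g h) => //; first by case: subD.
by move=> gh; apply: mem_dsum (clH _ _ Hg Hh gh) _ => //; apply: graded_mulM.
Qed.

Lemma homogeneous_ind P : additive_subgroup P -> (forall g, A g `<=` P) ->
  forall x, P x.
Proof.
move=> subP AP x; have : dsum setT A x by rewrite (graded_span gA).
by apply: dsum_sub => // g _; apply: AP.
Qed.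

Lemma graded_indep (s : seq G) (c : G -> S) : uniq s -> (forall g, A g (c g)) ->
  \sum_(g <- s) c g = 0 -> forall g, g \in s -> c g = 0.
Proof.
move=> us Ac sum0 g gs; pose d h := if h \in s then c h else 0.
suff: d g = 0 by rewrite /d gs.
apply: (graded_direct gA).
- by move=> h; rewrite /d; case: ifP => // _; case: (subA h).
- apply: (sub_finite_set _ (finite_seq s)) => h /=.
  by rewrite /d; case: ifP.
rewrite (fsbigE s) //; last by move=> h _ /negbTE; rewrite /d => ->.
rewrite (eq_bigl xpredT) => [|h]; last by rewrite in_setT.
by rewrite -[RHS]sum0; apply: eq_big_seq => h hs; rewrite /d hs.
Qed.

(** When [f g] is homogeneous of degree [phi g], the fiber of [phi] over [m]
    collects the component of degree [m] of the sum. *)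
Lemma graded_fiber_sum0 (s : seq G) (f : G -> S) (phi : G -> G) m :
  (forall g, g \in s -> A (phi g) (f g)) -> \sum_(g <- s) f g = 0 ->
  \sum_(g <- s | phi g == m) f g = 0.
Proof.
move=> Af sum0; pose t := undup [seq phi g | g <- s].
pose c k := \sum_(g <- s | phi g == k) f g.
have Ac k : A k (c k).
  by apply: additive_subgroup_sum => // g gs /eqP <-; apply: Af.
have [mt|mt] := boolP (m \in t); last first.
  rewrite big_seq_cond big1 // => g /andP[gs /eqP gm]; case/negP: mt.
  by rewrite mem_undup -gm map_f.
apply: (graded_indep t c (undup_uniq _) Ac _ m mt).
rewrite /c (exchange_big_dep xpredT) //= -[RHS]sum0; apply: eq_big_seq => g gs.
have pt : phi g \in t by rewrite mem_undup map_f.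
rewrite big_mkcond (bigD1_seq _ pt) ?undup_uniq //= eqxx big1 ?addr0 // => k.
by rewrite eq_sym => /negbTE ->.
Qed.

(** A nonzero [x] has a nonzero homogeneous component [a] that controls it: [a]
    is killed by homogeneous factors on both sides as soon as [x] is.  Indeed,
    among the [m] for which [k m h] is defined, [m] can be recovered from
    [k m h], so that no two components of [x] can cancel in
    [p ** x ** q]. *)
Lemma homogeneous_component H x : dsum H A x -> x <> 0 ->
  exists g a, [/\ H g, A g a, a <> 0 &
    forall k h p q, A k p -> A h q -> p ** x ** q = 0 -> p ** a ** q = 0].
Proof.
move=> /dsum_seq [s [c [us sc ->]]] xn0.
have [g gs cgn0] : exists2 g, g \in s & c g <> 0.
  apply: contrapT => nc; apply: xn0; rewrite big_seq big1 // => g gs.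
  by apply: contrapT => cgn0; apply: nc; exists g.
have [Hg Acg] := sc g gs; exists g, (c g); split=> // k h p q Ap Aq pxq0.
pose ok m := `[< gsource k = grange m /\ gsource m = grange h >].
have nok m : m \in s -> ~~ ok m -> p ** c m ** q = 0.
  move=> /sc [_ Acm] /asboolPn nkmh.
  have [km|km] := pselect (gsource k = grange m); last first.
    by rewrite (graded_mul_eq0 _ _ _ _ km Ap Acm) rmul0l.
  have mh : gsource m <> grange h by move=> mh; apply: nkmh.
  by rewrite -rmulA (graded_mul_eq0 _ _ _ _ mh Acm Aq) rmul0r.
have [okg|] := boolP (ok g); last exact: nok.
pose phi m := gcomp (gcomp k m) h.
have Aphi m : m \in [seq m <- s | ok m] -> A (phi m) (p ** c m ** q).
  rewrite mem_filter => /andP[/asboolP[km mh] /sc[_ Acm]].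
  by apply: graded_mulM; rewrite ?gsource_gcomp //; apply: graded_mulM.
(* The terms that are not composable vanish, and on the others [phi] is
   injective, so that the fiber of [phi] over [phi g] is reduced to [g]. *)
have sum0 : \sum_(m <- [seq m <- s | ok m]) p ** c m ** q = 0.
  rewrite big_filter -[RHS]pxq0 rmul_sumr rmul_suml [RHS](bigID ok) /=.
  rewrite [X in _ = _ + X]big_seq_cond [X in _ = _ + X]big1 ?addr0 // => m.
  by case/andP=> ms; apply: nok.
rewrite -[RHS](graded_fiber_sum0 _ _ _ (phi g) Aphi sum0) big_filter_cond.
rewrite big_mkcond (bigD1_seq g) //= okg eqxx /= big1 ?addr0 // => m mg.
case: ifP => // /andP[/asboolP[km mh] /eqP phimg]; case/eqP: mg.
have /asboolP [kg gh] := okg; apply: (gcompIl k) => //.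
by apply: (gcompIr h) phimg; rewrite gsource_gcomp.
Qed.

End GradedTheory.

(** * Local units and the elementwise form of primeness *)

Section NearlyEpsilonStrong.
Context {G : groupoid} {S : rngType} {A : G -> set S}.
Hypothesis hA : nearly_epsilon_strongly_graded A.
Implicit Types (H : set G) (g h k m : G) (a b p q x y z : S) (I J P : set S).

Let gA : graded A := hA.1.
Let subA g : additive_subgroup (A g) := graded_subgroup gA g.

Lemma mulset_ginv_sub g : A g `** A (ginv g) `<=` A (idm (grange g)).
Proof. by rewrite -gcompgV; apply: (graded_mul gA); rewrite grange_ginv. Qed.

Lemma graded_idl g u a : A (idm (grange g)) u -> A g a -> A g (u ** a).
Proof.
move=> Au Aa; have := graded_mulM gA _ _ _ _ (gsource_idm _) Au Aa.
by rewrite gcomp_id_l.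
Qed.

Lemma subrng_mulset_ginv g : subrng (A g `** A (ginv g)).
Proof.
split=> [|x y Tx]; first exact: mulset_additive.
move: y; apply: mulset_sub.
  exact/additive_subgroup_mull/mulset_additive.
move=> a b Aa Ab /=; rewrite rmulA; apply: mem_mulset => //.
by apply: graded_idl => //; apply: mulset_ginv_sub.
Qed.

(** [S_g = S_g S_{g^-1} S_g] writes [a] as a sum of products whose left factors
    lie in the s-unital ring [S_g S_{g^-1}]; a common unit of these factors is
    a unit for [a]. *)
Lemma local_unit_l g a : A g a ->
  exists2 u, (A g `** A (ginv g)) u & u ** a = a.
Proof.
have [unitT cubeA] := hA.2 g; rewrite -{1}cubeA => -[s sTA ->].
have [x /mapP[p /sTA[Tp _] ->] //|u Tu ux] :=
  common_unit_l _ (map fst s) (subrng_mulset_ginv g) unitT.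
exists u => //; rewrite rmul_sumr; apply: eq_big_seq => p ps.
by rewrite rmulA ux ?map_f.
Qed.

Lemma local_unit_r g a : A g a ->
  exists2 u, (A (ginv g) `** A g) u & a ** u = a.
Proof.
have [_ cubeA] := hA.2 g; rewrite -{1}cubeA.
move=> /(mulset_assoc_sub _ _ _ (subA g))[s sTA ->].
have [unitT _] := hA.2 (ginv g); have subT := subrng_mulset_ginv (ginv g).
rewrite ginvK in unitT subT.
have [x /mapP[p /sTA[_ Tp] ->] //|u Tu xu] :=
  common_unit_r _ (map snd s) subT unitT.
exists u => //; rewrite rmul_suml; apply: eq_big_seq => p ps.
by rewrite -rmulA xu ?map_f.
Qed.

Lemma homogeneous_unit_l g a : A g a ->
  exists2 u, A (idm (grange g)) u & u ** a = a.
Proof. by move=> /local_unit_l[u /mulset_ginv_sub Au ua]; exists u. Qed.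

Lemma homogeneous_unit_r g a : A g a ->
  exists2 u, A (idm (gsource g)) u & a ** u = a.
Proof.
move=> /local_unit_r[u Tu au]; exists u => //.
have := mulset_ginv_sub (ginv g); rewrite ginvK grange_ginv; exact.
Qed.

(** Otherwise [a] would kill [S_{g^-1} S_g], which contains a right unit
    of [a]. *)
Lemma mul_ginv_neq0 g a : A g a -> a <> 0 ->
  exists2 b, A (ginv g) b & a ** b <> 0.
Proof.
move=> Aa an0; apply: contrapT => nb; apply: an0.
have [u + <-] := local_unit_r _ _ Aa; move: u.
apply: (mulset_sub _ _ [set u | a ** u = 0]).
  exact: additive_subgroup_mull additive_subgroup0.
move=> b c Ab _ /=; rewrite rmulA (_ : a ** b = 0) ?rmul0l //.
by apply: contrapT => abn0; apply: nb; exists b.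
Qed.

Lemma ginv_mul_neq0 g a : A g a -> a <> 0 ->
  exists2 b, A (ginv g) b & b ** a <> 0.
Proof.
move=> Aa an0; apply: contrapT => nb; apply: an0.
have [u + <-] := local_unit_l _ _ Aa; move: u.
apply: (mulset_sub _ _ [set u | u ** a = 0]).
  exact: additive_subgroup_mulr additive_subgroup0.
move=> c b _ Ab /=; rewrite -rmulA (_ : b ** a = 0) ?rmul0r //.
by apply: contrapT => ban0; apply: nb; exists b.
Qed.

(** The local units [u], [v] of the component [a] controlling [x] satisfy
    [u ** a ** v = a <> 0], hence [u ** x ** v <> 0]. *)
Lemma dsum_prime_ringP H : gcomp_closed H ->
  (forall g, H g -> H (idm (gsource g)) /\ H (idm (grange g))) ->
  prime_ring (dsum H A) <->
  (forall x y, dsum H A x -> dsum H A y -> x <> 0 -> y <> 0 ->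
     exists2 t, dsum H A t & x ** t ** y <> 0).
Proof.
move=> clH idH; apply: prime_ringP; first exact: dsum_subrng.
move=> x Hx xn0.
have [g [a [Hg Aa an0 cancel]]] := homogeneous_component gA _ _ Hx xn0.
have [Hs Hr] := idH g Hg.
have [u Au ua] := homogeneous_unit_l _ _ Aa.
have [v Av av] := homogeneous_unit_r _ _ Aa.
exists u, v; split; [exact: mem_dsum Hr Au | exact: mem_dsum Hs Av|].
by move/(cancel _ _ _ _ Au Av); rewrite ua av.
Qed.

Lemma prime_isotropyP e : prime_ring (dsum (isotropy e) A) <->
  (forall x y, dsum (isotropy e) A x -> dsum (isotropy e) A y ->
     x <> 0 -> y <> 0 ->
     exists2 t, dsum (isotropy e) A t & x ** t ** y <> 0).
Proof.
apply: dsum_prime_ringP; first exact: isotropy_closed.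
by move=> g [-> ->]; split; split; rewrite ?gsource_idm ?grange_idm.
Qed.

Lemma primeP : prime_ring [set: S] <->
  (forall x y, x <> 0 -> y <> 0 -> exists t, x ** t ** y <> 0).
Proof.
rewrite -(graded_span gA); split.
  move/(dsum_prime_ringP _ gcomp_closedT (fun _ _ => conj I I)).
  rewrite (graded_span gA) => pS x y xn0 yn0.
  by have [] := pS x y; [by []..|move=> t _; exists t].
move=> pS; apply/(dsum_prime_ringP _ gcomp_closedT (fun _ _ => conj I I)).
rewrite (graded_span gA) => x y _ _ xn0 yn0.
by have [t xty] := pS x y xn0 yn0; exists t.
Qed.

(** * Support-hubs and isotropy rings *)

Lemma isotropy_corner g h e p q x :
  A g p -> A h q -> grange g = e -> gsource h = e ->
  dsum (isotropy e) A (p ** x ** q).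
Proof.
move=> Ap Aq rg sh; have subT := dsum_additive (isotropy e) A subA.
apply: (homogeneous_ind gA [set x | dsum _ A (p ** x ** q)]).
  exact: additive_subgroup_sandwich.
move=> m a Aa /=; have T0 : dsum (isotropy e) A 0 by case: subT.
have [gm|gm] := pselect (gsource g = grange m); last first.
  by rewrite (graded_mul_eq0 gA _ _ _ _ gm Ap Aa) rmul0l.
have Apa := graded_mulM gA _ _ _ _ gm Ap Aa.
apply: (graded_mul_ind gA _ _ _ _ _ T0 _ Apa Aq) => mh.
apply: mem_dsum (graded_mulM gA _ _ _ _ mh Apa Aq) => //.
by split; [rewrite gsource_gcomp | rewrite !grange_gcomp].
Qed.

(** The hub is used twice: for the component [a] controlling [x], to get [p],
    and then for [p ** a], to get [q]. *)
Lemma support_hub_corner e x : support_hub A e -> x <> 0 ->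
  exists p q, dsum (isotropy e) A (p ** x ** q) /\ p ** x ** q <> 0.
Proof.
move=> hub xn0; have Tx : dsum setT A x by rewrite (graded_span gA).
have [g [a [_ Aa an0 cancel]]] := homogeneous_component gA _ _ Tx xn0.
have [_ [k [_ rk _ /mulset_neq0P[p [_ [Ap -> pan0]]]]]] := hub g a Aa an0.
have kg := graded_mul_dom gA _ _ _ _ Ap Aa pan0.
have Apa := graded_mulM gA _ _ _ _ kg Ap Aa.
have [h [_ [sh _ /mulset_neq0P[_ [q [-> Aq paqn0]]] _]]] := hub _ _ Apa pan0.
exists p, q; split; first exact: isotropy_corner Ap Aq rk sh.
by move/(cancel _ _ _ _ Ap Aq).
Qed.

(** If [t] separates the corners [p ** x ** q] and [p' ** y ** q'], then
    [q ** t ** p'] separates [x] and [y]. *)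
Lemma prime_of_support_hub e : support_hub A e ->
  prime_ring (dsum (isotropy e) A) -> prime_ring [set: S].
Proof.
move=> hub /prime_isotropyP pT; apply/primeP => x y xn0 yn0.
have [p [q [Ta an0]]] := support_hub_corner _ _ hub xn0.
have [p' [q' [Tb bn0]]] := support_hub_corner _ _ hub yn0.
have [t _ atb] := pT _ _ Ta Tb an0 bn0.
exists (q ** t ** p') => xty; apply: atb.
have -> : p ** x ** q ** t ** (p' ** y ** q') =
    p ** (x ** (q ** t ** p') ** y) ** q' by rewrite !rmulA.
by rewrite xty rmul0r rmul0l.
Qed.

(** The elements of the isotropy ring at [e] have zero product with the
    homogeneous elements on their right whose range is not [e], and with those
    on their left whose source is not [e]. *)
Lemma isotropy_mul_neq0 e g x y s : dsum (isotropy e) A x -> dsum (isotropy e) A y ->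
  A g s -> x ** s ** y <> 0 -> isotropy e g.
Proof.
move=> Tx Ty As xsy; apply: contrapT => ng; apply: xsy.
have [rg|rg] := pselect (grange g = e).
  have sg : gsource g <> e by move=> sg; apply: ng.
  rewrite -rmulA (_ : s ** y = 0) ?rmul0r //; move: y Ty.
  apply: (dsum_sub _ _ [set y | s ** y = 0]).
    exact: additive_subgroup_mull additive_subgroup0.
  by move=> h [_ rh] b Ab; apply: (graded_mul_eq0 gA) As Ab; rewrite rh.
rewrite (_ : x ** s = 0) ?rmul0l //; move: x Tx.
apply: (dsum_sub _ _ [set x | x ** s = 0]).
  exact: additive_subgroup_mulr additive_subgroup0.
move=> h [sh _] b Ab; apply: (graded_mul_eq0 gA) Ab As.
by rewrite sh => /esym.
Qed.

Lemma sandwich_homogeneous x y s : x ** s ** y <> 0 ->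
  exists g, exists2 t, A g t & x ** t ** y <> 0.
Proof.
move=> xsy; apply: contrapT => nt; apply: xsy.
apply: (homogeneous_ind gA [set s | x ** s ** y = 0]) => [|g t At /=].
  exact: additive_subgroup_sandwich additive_subgroup0.
by apply: contrapT => xty; apply: nt; exists g, t.
Qed.

Lemma prime_isotropy e : prime_ring [set: S] -> prime_ring (dsum (isotropy e) A).
Proof.
move/primeP => pS; apply/prime_isotropyP => x y Tx Ty xn0 yn0.
have [s /sandwich_homogeneous[g [t At xty]]] := pS x y xn0 yn0.
exists t => //; apply: mem_dsum (At) => //.
exact: isotropy_mul_neq0 Tx Ty At xty.
Qed.

(** * Graded primeness *)

Lemma prime_graded_prime : prime_ring [set: S] -> graded_prime A.
Proof.
move=> pS [I [J [[idI _] [idJ _] In0 Jn0 IJ0]]].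
by apply: pS; exists I, J.
Qed.

Lemma graded_ideal_additive I : graded_ideal A I -> additive_subgroup I.
Proof. by case=> /ideal_additive. Qed.

Lemma subrngT : subrng [set: S].
Proof. by []. Qed.

Lemma principal_graded_ideal g a : A g a -> graded_ideal A (principal setT a).
Proof.
move=> Aa; have [subI mI] := principalP [set: S] a (additive_subgroupT).
split; first exact: principal_ideal subrngT _.
have subIA h : additive_subgroup (principal setT a `&` A h).
  exact: additive_subgroupI.
have subD := dsum_additive setT _ subIA; have D0 := subD.1.
apply/seteqP; split; last by apply: dsum_sub => // h _ z [].
apply: principal_sub => // s t _ _; move: s.
apply: (homogeneous_ind gA [set s | dsum _ _ (s ** a ** t)]).
  exact: (additive_subgroup_mulr a (additive_subgroup_mulr t subD)).
move=> k p Ap /=; move: t; apply: (homogeneous_ind gA) => [|h q Aq].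
  exact: additive_subgroup_mull.
have [kg|kg] := pselect (gsource k = grange g); last first.
  by rewrite (graded_mul_eq0 gA _ _ _ _ kg Ap Aa) rmul0l.
have Apa := graded_mulM gA _ _ _ _ kg Ap Aa.
apply: (graded_mul_ind gA _ _ _ _ _ D0 _ Apa Aq) => gh.
apply: (mem_dsum _ _ (gcomp (gcomp k g) h)) => //; split; first exact: mI.
exact: graded_mulM gA _ _ _ _ gh Apa Aq.
Qed.

Lemma graded_prime_homogeneous g h a b : graded_prime A ->
  A g a -> A h b -> a <> 0 -> b <> 0 ->
  exists k, exists2 t, A k t & a ** t ** b <> 0.
Proof.
move=> /(no_zero_productP graded_ideal_additive) pG Aa Ab an0 bn0.
suff [t] : exists t, a ** t ** b <> 0 by apply: sandwich_homogeneous.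
apply: contrapT => nt.
have aSb t : setT t -> a ** t ** b = 0.
  by move=> _; apply: contrapT => atb; apply: nt; exists t.
have mem_principal k c : A k c -> principal setT c c.
  move=> Ac; have [_ mI] := principalP [set: S] c additive_subgroupT.
  have [u _ uc] := homogeneous_unit_l _ _ Ac.
  have [v _ cv] := homogeneous_unit_r _ _ Ac.
  by have := mI u v I I; rewrite uc cv.
have [x [y [Ix Iy]]] := pG _ _ _ _ (principal_graded_ideal _ _ Aa)
  (principal_graded_ideal _ _ Ab) (mem_principal _ _ Aa) (mem_principal _ _ Ab)
  an0 bn0.
by apply; apply: (principal_mul_eq0 setT a b).
Qed.

(** A nonzero [z] in [S_e] can be linked to [a] on both sides: if
    [a ** s ** z] and [z ** t ** a] are nonzero, then [s ** z] and [z ** t]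
    are the homogeneous elements with source, respectively range, [e] that the
    definition of a support-hub asks for. *)
Lemma graded_prime_support_hub e : graded_prime A -> supp_obj A e -> support_hub A e.
Proof.
move=> pG /(nonzeroP (subA _).1)[z Az zn0] g a Aa an0.
have [h [s As asz]] := graded_prime_homogeneous _ _ _ _ pG Aa Az an0 zn0.
have [k [t At zta]] := graded_prime_homogeneous _ _ _ _ pG Az Aa zn0 an0.
have sz : s ** z <> 0 by move=> sz0; apply: asz; rewrite -rmulA sz0 rmul0r.
have zt : z ** t <> 0 by move=> zt0; apply: zta; rewrite zt0 rmul0l.
have hz := graded_mul_dom gA _ _ _ _ As Az sz.
have zk := graded_mul_dom gA _ _ _ _ Az At zt.
exists (gcomp h (idm e)), (gcomp (idm e) k); split.
- by rewrite gsource_gcomp // gsource_idm.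
- by rewrite grange_gcomp // grange_idm.
- apply/mulset_neq0P; exists a, (s ** z); split=> //; last by rewrite rmulA.
  exact: graded_mulM.
- apply/mulset_neq0P; exists (z ** t), a; split=> //.
  exact: graded_mulM.
Qed.

(** * Invariant ideals of the sum of the [S_e] *)

Definition base := dsum (@identities G) A.

Lemma base_subrng : subrng base.
Proof. exact/(dsum_subrng gA)/identities_closed. Qed.

Lemma mem_base e x : A (idm e) x -> base x.
Proof. by apply: mem_dsum => //; exists e. Qed.

Lemma invariant_ideal_additive I :
  ideal_of base I /\ Defs.invariant A I -> additive_subgroup I.
Proof. by case=> /ideal_additive. Qed.

Lemma ideal_trace_invariant I : ideal_of setT I -> Defs.invariant A (I `&` base).
Proof.
move=> [_ subI IMl IMr] g; have subR := base_subrng.1.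
apply: mulset_sub; first exact: additive_subgroupI.
move=> z q + Aq; move: z; apply: mulset_sub.
  exact/additive_subgroup_mulr/additive_subgroupI.
move=> p x Ap [Ix Rx] /=; split; first by apply: (IMr) => //; apply: (IMl).
move: x Rx {Ix}; apply: (dsum_sub _ _ [set x | base (p ** x ** q)]).
  exact: additive_subgroup_sandwich.
move=> _ [e _ <-] c Ac /=; have R0 := subR.1.
have [pc|pc] := pselect (gsource (ginv g) = grange (idm e)); last first.
  by rewrite (graded_mul_eq0 gA _ _ _ _ pc Ap Ac) rmul0l.
move: (pc); rewrite gsource_ginv grange_idm => ge; rewrite -ge in Ac.
have Acq := graded_idl _ _ _ Ac Aq; rewrite -rmulA.
apply: (mem_base (gsource g)); rewrite -gcompVg.
by apply: (graded_mulM gA) => //; rewrite gsource_ginv.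
Qed.

(** Intersecting graded ideals with [base] preserves being nonzero: a nonzero
    homogeneous [c] of degree [g] in the ideal gives the nonzero element
    [c ** b] over the range of [g], for a suitable [b] in [S_{g^-1}]. *)
Lemma G_prime_graded_prime : G_prime A -> graded_prime A.
Proof.
move=> /(no_zero_productP invariant_ideal_additive) pR.
apply/(no_zero_productP graded_ideal_additive) => I J x y gI gJ Ix Jy xn0 yn0.
have trace K z : graded_ideal A K -> K z -> z <> 0 ->
    [/\ ideal_of base (K `&` base), Defs.invariant A (K `&` base) &
       exists2 w, (K `&` base) w & w <> 0].
  move=> [idK KE] Kz zn0; have [_ subK KMl KMr] := idK.
  have [subR RM] := base_subrng; split.
  - split; [by move=> w []|exact: additive_subgroupI| |].
      by move=> t w Rt [Kw Rw]; split; [apply: KMl|apply: RM].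
    by move=> t w Rt [Kw Rw]; split; [apply: KMr|apply: RM].
  - exact: ideal_trace_invariant.
  - have [g [c [Kc Ac cn0]]] : exists g c, [/\ K c, A g c & c <> 0].
      apply: contrapT => nc; apply: zn0; move: Kz; rewrite KE.
      apply: (dsum_sub _ _ [set 0]) => [|g _ c [Kc Ac]].
        exact: additive_subgroup0.
      by apply: contrapT => cn0; apply: nc; exists g, c.
    have [b Ab cbn0] := mul_ginv_neq0 _ _ Ac cn0.
    exists (c ** b) => //; split; first exact: KMr.
    by apply: (mem_base (grange g)); apply: mulset_ginv_sub; apply: mem_mulset.
have [idI invI [v Iv vn0]] := trace I x gI Ix xn0.
have [idJ invJ [w Jw wn0]] := trace J y gJ Jy yn0.
have [a [b [[Ia _] [Jb _] ab]]] :=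
  pR _ _ _ _ (conj idI invI) (conj idJ invJ) Iv Jw vn0 wn0.
by exists a, b.
Qed.

(** A local unit of the component over [e] kills all other components, so
    this component is [u ** x] and belongs to [I]. *)
Lemma ideal_base_component I x : ideal_of base I -> I x -> x <> 0 ->
  exists e a, [/\ I a, A (idm e) a & a <> 0].
Proof.
move=> [IR subI IMl _] Ix xn0; have [s [c [us sc xE]]] := dsum_seq _ _ _ (IR _ Ix).
have [m ms cn0] : exists2 g, g \in s & c g <> 0.
  apply: contrapT => nc; apply: xn0; rewrite xE big_seq big1 // => g gs.
  by apply: contrapT => cgn0; apply: nc; exists g.
have [[e _ em] Ac] := sc m ms; subst m; exists e, (c (idm e)); split=> //.
have [u] := homogeneous_unit_l _ _ Ac; rewrite grange_idm => Au uc.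
have -> : c (idm e) = u ** x; last by apply: IMl => //; apply: mem_base Au.
rewrite xE rmul_sumr (bigD1_seq _ ms) //= uc big_seq_cond big1 ?addr0 // => g.
move=> /andP[/sc[[f _ <-] Acf] fe]; apply: (graded_mul_eq0 gA) Au Acf.
by rewrite gsource_idm grange_idm => ef; case/eqP: fe; rewrite ef.
Qed.

(** If [t] of degree [k] separates [a] in [I] from [b] in [J], then
    [r ** (a ** t ** b)] is still nonzero for some [r] in [S_{k^-1}]; by
    invariance [r ** a ** t] is in [I], so it has a nonzero product with [b]
    in [J]. *)
Lemma graded_prime_G_prime : graded_prime A -> G_prime A.
Proof.
move=> pG; apply/(no_zero_productP invariant_ideal_additive).
move=> I J x y [idI invI] [idJ _] Ix Jy xn0 yn0.
have [e [a [Ia Aa an0]]] := ideal_base_component _ _ idI Ix xn0.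
have [f [b [Jb Ab bn0]]] := ideal_base_component _ _ idJ Jy yn0.
have [k [t At atb]] := graded_prime_homogeneous _ _ _ _ pG Aa Ab an0 bn0.
have at0 : a ** t <> 0 by move=> at0; apply: atb; rewrite at0 rmul0l.
have ek := graded_mul_dom gA _ _ _ _ Aa At at0.
have kf : gsource k = f.
  have Aat := graded_mulM gA _ _ _ _ ek Aa At.
  have := graded_mul_dom gA _ _ _ _ Aat Ab atb.
  by rewrite gsource_gcomp // grange_idm.
move: (ek); rewrite gsource_idm => re; subst e f.
have Aat : A k (a ** t) by apply: graded_idl.
have Aatb : A k (a ** t ** b).
  have := graded_mulM gA _ _ _ _ (esym (grange_idm _)) Aat Ab.
  by rewrite gcomp_id_r.
have [r Ar ratb] := ginv_mul_neq0 _ _ Aatb atb.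
exists (r ** a ** t), b; split=> //; last by rewrite -!rmulA !(rmulA a).
by apply: (invI k); do 2!apply: mem_mulset => //.
Qed.

Lemma supp_obj_nonempty : [set: S] <> [set 0] -> exists e, supp_obj A e.
Proof.
move=> /(nonzeroP (X := setT) I)[x _ xn0].
have Tx : dsum setT A x by rewrite (graded_span gA).
have [g [a [_ Aa an0 _]]] := homogeneous_component gA _ _ Tx xn0.
have [u Au ua] := homogeneous_unit_l _ _ Aa.
exists (grange g); apply: neq_set0_of Au _ => u0.
by apply: an0; rewrite -ua u0 rmul0l.
Qed.

End NearlyEpsilonStrong.

(** * The equivalence *)

Theorem theorem1p1 (G : groupoid) (S : rngType) (A : G -> set S)
    (hA : nearly_epsilon_strongly_graded A) (hS : [set: S] <> [set 0]) :
  [<-> (* i *)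
       prime_ring [set: S];
       (* ii *)
       G_prime A /\
         (forall e, supp_obj A e -> prime_ring (dsum (isotropy e) A));
       (* iii *)
       G_prime A /\
         (exists e, supp_obj A e /\ prime_ring (dsum (isotropy e) A));
       (* iv *)
       graded_prime A /\
         (forall e, supp_obj A e -> prime_ring (dsum (isotropy e) A));
       (* v *)
       graded_prime A /\
         (exists e, supp_obj A e /\ prime_ring (dsum (isotropy e) A));
       (* vi *)
       forall e, supp_obj A e ->
         support_hub A e /\ prime_ring (dsum (isotropy e) A);
       (* vii *)
       exists e, supp_obj A e /\
         (support_hub A e /\ prime_ring (dsum (isotropy e) A))].
Proof.
have [e0 e0supp] := supp_obj_nonempty hA hS.
have prime_of_one : graded_prime A ->
    (exists e, supp_obj A e /\ prime_ring (dsum (isotropy e) A)) ->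
    prime_ring [set: S].
  move=> pG [e [esupp pe]]; apply: (prime_of_support_hub hA e) pe.
  exact: graded_prime_support_hub.
tfae.
- move=> pS; split=> [|e _]; last exact: prime_isotropy.
  exact/graded_prime_G_prime/prime_graded_prime.
- by move=> [pR pT]; split=> //; exists e0; split=> //; apply: pT.
- move=> [/(G_prime_graded_prime hA) pG pe]; split=> // e _.
  exact/(prime_isotropy hA)/prime_of_one.
- by move=> [pG pT]; split=> //; exists e0; split=> //; apply: pT.
- move=> [pG pe] e esupp; split; first exact: graded_prime_support_hub.
  exact/(prime_isotropy hA)/prime_of_one.
- by move=> hub; exists e0; split=> //; apply: hub.
- by move=> [e [_ [hub pe]]]; apply: prime_of_support_hub hub pe.
Qed.
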